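(* There is a polynomial $p$ such that for every $n>0$ there are finite alphabets $\Sigma_I,\Sigma_O$ and a language $L_n\subseteq(\Sigma_I\times\Sigma_O)^\omega$ recognized by a Streett automaton with costs $\mathcal{A}_n$ of size at most $p(n)$ such that: (i) there is a delay function $f$ for which Player $O$ has a winning strategy $\tau_O$ in $\Gamma_f(L_n)$ with $\mathrm{Cst}(\tau_O)=n$; and (ii) for every delay function $f$, if Player $O$ has a winning strategy $\tau_O$ in $\Gamma_f(L_n)$ with $\mathrm{Cst}(\tau_O)=n$, then $f$ eventually grants a lookahead of size $n\cdot(2^{2^n}-1)$.
   Context: A Streett automaton with costs is a tuple $\mathcal{A}=(Q,\Sigma,q_I,\delta,(Q_j,P_j)_{j\in J},(\mathrm{Cst}_j)_{j\in J})$ with a finite set $Q$ of states, a finite alphabet $\Sigma$, an initial state $q_I$, a deterministic complete transition function $\delta\colon Q\times\Sigma\to Q$, a finite family of Streett pairs $(Q_j,P_j)$ with $Q_j,P_j\subseteq Q$, and for each $j\in J$ a cost function $\mathrm{Cst}_j$ assigning to every transition $(q,a,\delta(q,a))$ either $\epsilon$ or $\mathtt{i}$. Its size is $|Q|+|J|$. The run on $a_0a_1\cdots$ is $\rho=(q_0,a_0,q_1)(q_1,a_1,q_2)\cdots$ with $q_0=q_I$, $q_{m+1}=\delta(q_m,a_m)$. For position $n$, $\mathrm{StCor}_j(\rho,n)=0$ if $q_n\notin Q_j$, and otherwise it is the minimum, over all $n'\ge n$ with $q_{n'}\in P_j$, of the number of transitions among $(q_n,a_n,q_{n+1})\cdots(q_{n'-1},a_{n'-1},q_{n'})$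 that $\mathrm{Cst}_j$ maps to $\mathtt{i}$ ($\min\emptyset=\infty$). Let $\mathrm{StCor}(\rho,n)=\max_{j\in J}\mathrm{StCor}_j(\rho,n)$. The run is accepting if $\limsup_{n\to\infty}\mathrm{StCor}(\rho,n)<\infty$, and $L(\mathcal{A})$ is the set of infinite words whose run is accepting. A delay function is a map $f\colon\mathbb{N}\to\mathbb{N}\setminus\{0\}$; it eventually grants a lookahead of size $m$ if there is an $i$ with $\sum_{0\le i'\le i}(f(i')-1)\ge m$. For $L\subseteq(\Sigma_I\times\Sigma_O)^\omega$, the delay game $\Gamma_f(L)$ is played in rounds $i=0,1,2,\ldots$: in round $i$, Player $I$ picks $u_i\in\Sigma_I^{f(i)}$, then Player $O$ picks $v_i\in\Sigma_O$. Player $O$ wins the play if the outcome, i.e., the word over $\Sigma_I\times\Sigma_O$ pairing $u_0u_1u_2\cdots$ and $v_0v_1v_2\cdots$ letterwise, is in $L$. A strategy for Player $O$ is a map $\tau_O\colon\Sigma_I^*\to\Sigma_O$; a play is consistent with $\tau_O$ if $v_i=\tau_O(u_0\cdots u_i)$ for all $i$; $\tau_O$ is winning if every consistent play is won by Player $O$. For a winning strategy $\tau_O$ in $\Gamma_f(L(\mathcal{A}_n))$, its cost is $\mathrm{Cst}(\tau_O)=\sup_w\limsup_{m\to\infty}\mathrm{StCor}(\rho(w),m)$, where $w$ ranges over outcomes of plays consistent with $\tau_O$ and $\rho(w)$ is the run of $\mathcal{A}_n$ on $w$. *)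

(* Defs.v *)
From HB Require Import structures.
From mathcomp Require Import all_boot all_order all_algebra.
From mathcomp Require Import all_classical all_reals all_analysis.
From mathcomp Require Import Rstruct Rstruct_topology.
Unset Printing Implicit Defensive.
Import Order.TTheory GRing.Theory Num.Theory.
Local Open Scope classical_set_scope.
Local Open Scope ring_scope.

(* Streett automaton with costs over alphabet Sigma.
   - deterministic complete transition function st_delta;
   - Streett pairs (st_req j, st_resp j) = (Q_j, P_j), j in the finite index type st_J;
   - st_cost j q a = true  iff  Cst_j maps the transition (q, a, delta q a) to 'i'
     (false means epsilon).  Since delta is deterministic, a transition is
     determined by (q, a). *)
Record streett_cost (Sigma : finType) := StreettCost {
  st_Q : finType;
  st_init : st_Q;
  st_delta : st_Q -> Sigma -> st_Q;
  st_J : finType;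
  st_req : st_J -> {set st_Q};
  st_resp : st_J -> {set st_Q};
  st_cost : st_J -> st_Q -> Sigma -> bool
}.
Arguments st_Q {Sigma}. Arguments st_init {Sigma}. Arguments st_delta {Sigma}.
Arguments st_J {Sigma}. Arguments st_req {Sigma}. Arguments st_resp {Sigma}.
Arguments st_cost {Sigma}.

Definition st_size {Sigma : finType} (A : streett_cost Sigma) : nat :=
  (#|st_Q A| + #|st_J A|)%N.

Fixpoint run_state {Sigma : finType} (A : streett_cost Sigma) (w : nat -> Sigma)
  (n : nat) : st_Q A :=
  match n with
  | 0 => st_init A
  | m.+1 => st_delta A (run_state A w m) (w m)
  end.

Definition inc_count {Sigma : finType} (A : streett_cost Sigma) (j : st_J A)
  (w : nat -> Sigma) (n n' : nat) : nat :=
  (\sum_(n <= k < n') (st_cost A j (run_state A w k) (w k) : nat))%N.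

(* StCor_j(rho, n), an extended real (ereal_inf of the empty set is +oo) *)
Definition StCor_j {Sigma : finType} (A : streett_cost Sigma) (w : nat -> Sigma)
  (n : nat) (j : st_J A) : \bar Rdefinitions.R :=
  if run_state A w n \in st_req A j then
    ereal_inf [set ((inc_count A j w n n')%:R)%:E
                 | n' in [set n' | (n <= n')%N /\ run_state A w n' \in st_resp A j]]
  else 0%E.

(* StCor(rho, n) = max_j StCor_j(rho, n) (values are >= 0, so 0 is the neutral element) *)
Definition StCor {Sigma : finType} (A : streett_cost Sigma) (w : nat -> Sigma)
  (n : nat) : \bar Rdefinitions.R :=
  \big[maxe/0%E]_(j : st_J A) StCor_j A w n j.

Definition accepting {Sigma : finType} (A : streett_cost Sigma) (w : nat -> Sigma) : Prop :=
  (limn_esup (StCor A w) < +oo)%E.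

Definition lang {Sigma : finType} (A : streett_cost Sigma) : set (nat -> Sigma) :=
  [set w | accepting A w].

Definition delay_function (f : nat -> nat) : Prop := forall i, (0 < f i)%N.

Definition grants_lookahead (f : nat -> nat) (m : nat) : Prop :=
  exists i, (m <= \sum_(i' < i.+1) (f i' - 1))%N.

(* Outcome of the play in Gamma_f in which Player I's concatenated choices
   u_0 u_1 u_2 ... form the input word x, and Player O plays according to tau:
   v_i = tau(u_0 ... u_i), where u_0...u_i is the prefix of x of length
   f(0) + ... + f(i). *)
Definition outcome {SI SO : finType} (f : nat -> nat) (tau : seq SI -> SO)
  (x : nat -> SI) : nat -> (SI * SO)%type :=
  fun n => (x n, tau (mkseq x (\sum_(i < n.+1) f i)%N)).

Definition winning_strategy {SI SO : finType} (f : nat -> nat)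
  (A : streett_cost (SI * SO)%type) (tau : seq SI -> SO) : Prop :=
  forall x : nat -> SI, lang A (outcome f tau x).

Definition strategy_cost {SI SO : finType} (f : nat -> nat)
  (A : streett_cost (SI * SO)%type) (tau : seq SI -> SO) : \bar Rdefinitions.R :=
  ereal_sup [set limn_esup (StCor A (outcome f tau x)) | x in [set: nat -> SI]].

(* Main.v *)
(** Player I's input is a sequence of blocks of [n] ternary digits, each coding
a number below [3 ^ n], and [None] is a letter that restarts the game. After a
restart Player O announces such a number [c], digit by digit, and repeats it in
every block; she succeeds in the first block that closes a bad [c]-pair, i.e.,
two blocks equal to [c] with no larger block in between. The comparison of [c]
with a block is done digit by digit, so the automaton never stores [c];
instead, Streett pairs request that a digit announced at some position be
announced again [n] transitions later. Every transition has cost [i] for these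
pairs, hence keeping [c] costs exactly [n] and changing [c] costs more.

Any [2 ^ 3 ^ n] blocks contain a bad pair, so a lookahead of that many blocks
suffices for cost [n]. Conversely, [logn 2 1], [logn 2 2], ..., [logn 2 (2 ^ 3
^ n - 1)] contains no bad pair. With a smaller lookahead Player O has to
announce [c] while seeing only this sequence, after which Player I plays
forever a number different from [c]. To succeed, Player O must change [c]; then
Player I restarts, infinitely often. *)
Require Import Defs.
From HB Require Import structures.
From mathcomp Require Import all_boot all_order all_algebra.
From mathcomp Require Import all_classical all_reals all_analysis.
From mathcomp Require Import Rstruct Rstruct_topology.
From mathcomp Require Import zify.
Import Order.TTheory GRing.Theory Num.Theory.
Local Open Scope classical_set_scope.
Local Open Scope ring_scope.

Set Implicit Arguments.
Unset Strict Implicit.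

(** * Bounds on limits superior and on the cost of a position *)

Lemma limn_esup_le_bound (u : nat -> \bar Rdefinitions.R) (l : \bar Rdefinitions.R) :
  (forall s, (u s <= l)%E) -> (limn_esup u <= l)%E.
Proof.
move=> ul; rewrite /limn_esup /limf_esup; apply: ge_ereal_inf.
exists (ereal_sup (u @` setT)); first by exists setT => //; exact: filterT.
by apply: ge_ereal_sup => _ [s _ <-].
Qed.

Lemma limn_esup_ge_frequently (u : nat -> \bar Rdefinitions.R) (l : \bar Rdefinitions.R) :
  (forall N, exists2 s, (N <= s)%N & (l <= u s)%E) -> (l <= limn_esup u)%E.
Proof.
move=> lu; rewrite /limn_esup /limf_esup; apply: le_ereal_inf_tmp.
move=> _ [V [N _ NV] <-]; have [s Ns ls] := lu N.
by apply: le_trans ls _; apply: ereal_sup_ubound; exists s => //; apply: NV.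
Qed.

Section StCor.
Variables (Sigma : finType) (A : streett_cost Sigma) (w : nat -> Sigma).

Lemma StCor_le s N :
  (forall j, run_state A w s \in st_req A j ->
     exists2 r, (s <= r)%N /\ run_state A w r \in st_resp A j &
       (inc_count A j w s r <= N)%N) ->
  (StCor A w s <= N%:R%:E)%E.
Proof.
move=> Nresp; rewrite /StCor; apply: (big_ind (fun e => (e <= N%:R%:E)%E)).
- by rewrite lee_fin ler0n.
- by move=> a b aN bN; rewrite ge_max aN bN.
- move=> j _; rewrite /StCor_j; case: ifPn => [/Nresp[r hr le_rN]|_].
    apply: ge_ereal_inf; exists (inc_count A j w s r)%:R%:E; first by exists r.
    by rewrite lee_fin ler_nat.
  by rewrite lee_fin ler0n.
Qed.

Lemma StCor_ge s j (l : \bar Rdefinitions.R) : run_state A w s \in st_req A j ->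
  (forall r, (s <= r)%N -> run_state A w r \in st_resp A j ->
     (l <= (inc_count A j w s r)%:R%:E)%E) ->
  (l <= StCor A w s)%E.
Proof.
move=> sj lr; rewrite /StCor (bigD1 j) //= le_max /StCor_j sj; apply/orP; left.
by apply: le_ereal_inf_tmp => _ [r [le_sr r_resp] <-]; apply: lr.
Qed.

End StCor.

Local Open Scope nat_scope.

(** * Bad pairs *)

Fixpoint number (d : nat -> nat) i :=
  if i is k.+1 then 3 * number d k + d k else 0.

Lemma numberS d i : number d i.+1 = 3 * number d i + d i.
Proof. by []. Qed.

(* Digits are indexed from the most significant one. *)
Definition digit n c i := c %/ 3 ^ (n - i.+1) %% 3.

Definition cmp (u v : nat) : option bool := if u == v then None else Some (u < v).

Definition refine r d e := if r is None then cmp d e else r.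

Lemma digit_lt3 n c i : digit n c i < 3.
Proof. by rewrite ltn_mod. Qed.

Lemma eq_number d e i : (forall k, k < i -> d k = e k) -> number d i = number e i.
Proof.
elim: i => //= i IHi eq_de; rewrite eq_de ?IHi // => k lt_ki.
exact/eq_de/ltnW.
Qed.

Lemma number_lt d i : (forall k, d k < 3) -> number d i < 3 ^ i.
Proof. move=> d3; elim: i => //= i IHi; rewrite expnS; have := d3 i; lia. Qed.

Lemma number_digit n c i : c < 3 ^ n -> i <= n -> number (digit n c) i = c %/ 3 ^ (n - i).
Proof.
move=> lt_c; elim: i => [|i IHi] lt_in /=; first by rewrite subn0 divn_small.
rewrite IHi 1?ltnW // /digit -(subnSK lt_in) expnSr divnMA.
by rewrite mulnC -divn_eq.
Qed.

(** A difference between the prefixes outweighs any next digit, so three values suffice to compare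
    two numbers while reading them. *)
Lemma cmp_refine u v d e : d < 3 -> e < 3 ->
  cmp (3 * u + d) (3 * v + e) = refine (cmp u v) d e.
Proof.
move=> lt_d lt_e; rewrite /refine /cmp; case: (ltngtP u v) => [lt_uv|lt_vu|->].
- by rewrite ifF; [congr Some|]; lia.
- by rewrite ifF; [congr Some|]; lia.
- by rewrite eqn_add2l ltn_add2l.
Qed.

(** * Bad pairs: unavoidable in long sequences, absent from 2-adic valuations *)

Definition bad_pair (A : nat -> nat) c p q :=
  [/\ p < q, A p = c, A q = c & forall r, p < r < q -> A r <= c].

(** Two occurrences of the top value [M] among [2 ^ M.+1] entries give a bad pair; otherwise one
    half of the window avoids [M] and the induction applies. The start [s] varies to reach the
    second half. *)
Lemma bad_pair_exists A M : (forall k, k < 2 ^ M -> A k < M) ->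
  exists c p q, [/\ c < M, q < 2 ^ M & bad_pair A c p q].
Proof.
suff main s : (forall k, s <= k < s + 2 ^ M -> A k < M) ->
    exists c p q, [/\ c < M, s <= p, q < s + 2 ^ M & bad_pair A c p q].
  move=> ltM; have [k hk|c [p [q [? ? ? ?]]]] := main 0; first by apply: ltM; lia.
  by exists c, p, q.
elim: M s => [|M IHM] s ltM; first by have := ltM s; rewrite expn0 => /(_ ltac:(lia)).
case: (boolP [exists p : 'I_(2 ^ M.+1), exists q : 'I_(2 ^ M.+1),
   [&& p < q, A (s + p) == M & A (s + q) == M]]) => [|none].
  move=> /existsP[p /existsP[q /and3P[lt_pq /eqP Ap /eqP Aq]]].
  exists M, (s + p), (s + q); split; rewrite ?leq_addr ?ltn_add2l //.
  split=> //; first by rewrite ltn_add2l.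
  by move=> r lt_r; apply: (ltM r); have := ltn_ord q; lia.
have {}none p q : s <= p < s + 2 ^ M.+1 -> s <= q < s + 2 ^ M.+1 ->
  A p = M -> A q = M -> ~ p < q.
  move=> hp hq Ap Aq lt_pq; case/negP: none.
  have ip : p - s < 2 ^ M.+1 by lia.
  have iq : q - s < 2 ^ M.+1 by lia.
  apply/existsP; exists (Ordinal ip); apply/existsP; exists (Ordinal iq) => /=.
  by rewrite !subnKC ?Ap ?Aq ?eqxx; lia.
have [sM|] : (forall k, s <= k < s + 2 ^ M -> A k < M) \/
    (forall k, s + 2 ^ M <= k < s + 2 ^ M + 2 ^ M -> A k < M).
- case: (boolP [exists k : 'I_(2 ^ M), A (s + k) == M]) => [/existsP[k /eqP Ak]|no].
    right=> l hl; rewrite ltn_neqAle -ltnS ltM ?expnS ?andbT; last by lia.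
    have := ltn_ord k; rewrite expnS in none => ?.
    by apply/eqP => Al; apply: (none (s + k) l) => //; lia.
  left=> l hl; rewrite ltn_neqAle -ltnS ltM ?expnS ?andbT; last by lia.
  apply: contra no => Al; have il : l - s < 2 ^ M by lia.
  by apply/existsP; exists (Ordinal il); rewrite /= subnKC //; lia.
- have [c [p [q [? ? ? ?]]]] := IHM s sM.
  by exists c, p, q; split=> //; rewrite ?expnS; lia.
- move=> /IHM[c [p [q [? ? ? ?]]]].
  by exists c, p, q; split=> //; rewrite ?expnS; lia.
Qed.

(** Write [p = a * 2 ^ v] and [q = b * 2 ^ v] with [a < b] both odd; the even number [a.+1] lies
    strictly between them. *)
Lemma logn2_between p q v : 0 < p -> p < q -> logn 2 p = v -> logn 2 q = v ->
  exists r, p < r < q /\ v < logn 2 r.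
Proof.
move=> p_gt0 lt_pq lp lq; have q_gt0 : 0 < q by lia.
have [a ca ea] := pfactor_coprime (isT : prime 2) p_gt0.
have [b cb eb] := pfactor_coprime (isT : prime 2) q_gt0.
rewrite lp in ea; rewrite lq in eb; rewrite !coprime2n in ca cb.
have v_gt0 : 0 < 2 ^ v by rewrite expn_gt0.
have lt_ab : a < b by rewrite ea eb ltn_pmul2r in lt_pq.
have lt_ab1 : a.+1 < b.
  rewrite ltn_neqAle lt_ab andbT; apply: contraTneq cb => <- /=; by rewrite negbK.
exists (a.+1 * 2 ^ v); split; first by rewrite ea eb !ltn_pmul2r // ltnSn.
rewrite -pfactor_dvdn ?muln_gt0 // expnS dvdn_pmul2r //.
by rewrite dvdn2 /= ca.
Qed.

(** * Detection of bad pairs, block by block *)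

Definition next_phase r ph := if r is Some lt then lt && ph else true.

Fixpoint phase (A C : nat -> nat) k :=
  if k is l.+1 then next_phase (cmp (A l) (C l)) (phase A C l) else false.

Definition success A C k := (A k == C k) && phase A C k.

(** [C] is constrained only up to the first success, since the round ends there. Without earlier
    success, the phase is set after [p] and survives up to [q]. *)
Lemma bad_pair_success A C c p q : bad_pair A c p q ->
  (forall k, (forall l, l < k -> ~~ success A C l) -> C k = c) ->
  exists2 k, k <= q & success A C k.
Proof.
move=> [lt_pq Ap Aq le_c] Cc.
case: (boolP [exists k : 'I_q.+1, success A C k]) => [/existsP[k sk]|no].
  by exists k; first exact: leq_ord.
have {}no k : k <= q -> ~~ success A C k.
  rewrite -ltnS => lt_k; apply: contra no => sk.
  by apply/existsP; exists (Ordinal lt_k).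
have {}Cc k : k <= q -> C k = c by move=> lekq; apply: Cc => l ltlk; apply: no; lia.
have ph k : p < k <= q -> phase A C k.
  elim: k => // k IHk /andP[]; rewrite ltnS leq_eqVlt => /predU1P[<- le_q|lt_pk le_q].
    by rewrite /= Cc 1?ltnW // Ap /cmp eqxx.
  rewrite /= Cc 1?ltnW // /cmp; case: eqP => //= /eqP neq.
  by rewrite ltn_neqAle neq le_c ?lt_pk // IHk // lt_pk ltnW.
by have := no q (leqnn q); rewrite /success Cc // Aq eqxx ph // lt_pq leqnn.
Qed.

(** The left end is the last block before [k] equal to [c]; a larger block after it would have
    cleared the phase. *)
Lemma success_bad_pair A C c k : (forall l, l <= k -> C l = c) ->
  success A C k -> exists p, bad_pair A c p k.
Proof.
move=> Cc /andP[/eqP Ak phk]; rewrite Cc // in Ak.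
have: exists2 p, p < k & A p = c /\ forall r, p < r < k -> A r <= c.
  elim: k Cc phk {Ak} => //= k IHk Cc.
  rewrite Cc // /cmp; case: eqP => [Ak _|neq /= /andP[lt_Ak phk]].
    by exists k => //; split=> // r; lia.
  have [|p lt_pk [Ap ler]] := IHk _ phk; first by move=> l ?; apply: Cc; lia.
  exists p; first lia; split=> // r hr.
  have [->|] := eqVneq r k; first exact: ltnW.
  by move=> ?; apply: ler; lia.
by case=> p ? [? ?]; exists p; split.
Qed.

(** * The automaton *)

Lemma run_stateS (Sigma : finType) (A : streett_cost Sigma) w m :
  run_state A w m.+1 = st_delta A (run_state A w m) (w m).
Proof. by []. Qed.

Section Automaton.
Variables (n : nat) (n_gt0 : 0 < n).

Definition clock l : 'I_n.*2 :=
  Ordinal (ltn_pmod l (etrans (double_gt0 n) n_gt0)).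

Definition letter : finType := (option 'I_3 * 'I_3)%type.
(* [inl true] starts a round and [inl false] is reached by success.  In
   [inr (k, b, r, ph)], the last letter was read at position [k] modulo [2n] of
   the round and contained Player O's digit [b]; [r] compares the prefixes of
   the current block of Player I and of Player O ([Some true]: less), and [ph]
   tells whether an earlier block was equal to Player O's with no larger one
   since. *)
Definition state := (bool + 'I_n.*2 * 'I_3 * option bool * bool)%type.

Definition step (q : state) (a : letter) : state :=
  if a.1 is Some d then
    match q with
    | inl false => inl false
    | inl true => inr (clock 0, a.2, cmp d a.2, false)
    | inr (k, _, r, ph) =>
        if n %| k.+1 then
          if (r == None) && ph then inl false
          else inr (clock k.+1, a.2, cmp d a.2, next_phase r ph)
        else inr (clock k.+1, a.2, refine r d a.2, ph)
    end
  else inl true.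

Definition idle (q : state) : bool := if q is inl _ then true else false.

Definition tick (q : state) : option ('I_n.*2 * 'I_3) :=
  if q is inr (k, b, _, _) then Some (k, b) else None.

(* The pair [None] asks for success, the pair [Some (k, b)] for the digit [b] to
   be repeated in the next block.  Since the clock counts modulo [2n] instead of
   [n], no state answers its own request. *)
Definition request (j : option ('I_n.*2 * 'I_3)) : {set state} :=
  [set q | ~~ idle q && ((j == None) || (j == tick q))].

(** Success and restart release Player O from all pending digits. *)
Definition response (j : option ('I_n.*2 * 'I_3)) : {set state} :=
  [set q | idle q ||
     (if j is Some (k, b) then tick q == Some (clock (k + n), b) else false)].

Definition automaton : streett_cost letter :=
  StreettCost letter state (inl true) step (option ('I_n.*2 * 'I_3)) request response
    (fun j _ _ => j != None).

(** There are [2 + 36 * n] states and [6 * n + 1] pairs. *)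
Lemma size_automaton : st_size automaton = 42 * n + 3.
Proof.
rewrite /st_size /= card_sum card_bool !card_prod !card_option !card_prod.
by rewrite !card_ord card_bool; lia.
Qed.

Definition input (w : nat -> letter) i : nat := if (w i).1 is Some d then d else 0.
Definition output (w : nat -> letter) i : nat := (w i).2.

Definition block (d : nat -> nat) t k := number (fun i => d (t + n * k + i)) n.

Lemma clock_modn l : clock l %% n = l %% n.
Proof. by rewrite modn_dvdm // -muln2 dvdn_mulr. Qed.

Lemma eq_clock k l : k %% n.*2 = l %% n.*2 -> clock k = clock l.
Proof. by move=> eq_kl; apply: val_inj. Qed.

Lemma clock_modnS l : (clock l).+1 %% n = l.+1 %% n.
Proof. by rewrite -(addn1 (clock l)) -modnDml clock_modn modnDml addn1. Qed.

Lemma dvdn_clockS l : (n %| (clock l).+1) = (n %| l.+1).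
Proof. by rewrite /dvdn clock_modnS. Qed.

(** The invariant of a round. Success is excluded only for completed blocks, as the automaton
    notices it on the first letter of the next block. *)
Lemma run_round w t l :
  run_state automaton w t = inl true ->
  (forall i, i <= l -> (w (t + i)).1 != None) ->
  (forall k, k < l %/ n ->
     ~~ success (block (input w) t) (block (output w) t) k) ->
  run_state automaton w (t + l).+1 =
    inr (clock l, (w (t + l)).2,
         cmp (number (fun i => input w (t + n * (l %/ n) + i)) (l %% n).+1)
             (number (fun i => output w (t + n * (l %/ n) + i)) (l %% n).+1),
         phase (block (input w) t) (block (output w) t) (l %/ n)).
Proof.
move=> qt; elim: l => [|l IHl] no_reset no_success.
  rewrite addn0 /= qt /step; have := no_reset 0 isT; rewrite addn0.
  rewrite div0n mod0n muln0 /= !muln0 !addn0 /input /output.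
  by case: (w t).1.
have nr := no_reset _ (leqnn _).
rewrite run_stateS {1}addnS IHl => [|i le_il|k lt_k]; last 2 first.
- by apply: no_reset; lia.
- by apply: no_success; apply: leq_trans lt_k _; apply: leq_div2r.
rewrite [st_delta _]/= /step; case E : (w (t + l.+1)).1 nr => [d|] // _.
have Ed : input w (t + l.+1) = d by rewrite /input E.
rewrite dvdn_clockS (@eq_clock (clock l).+1 l.+1); last first.
  by rewrite /= -addn1 modnDml addn1.
have ld := divn_eq l n; have lm := ltn_pmod l n_gt0.
(* A multiple of [n] opens a block: the comparison restarts and the finished block updates the
   phase. *)
rewrite divnS // modnS; case: ifPn => [dv|ndv]; last first.
  rewrite add0n; congr inr; congr (_, _, _, _).
  have e : t + n * (l %/ n) + (l %% n).+1 = t + l.+1 by rewrite -addnA mulnC addnS -ld.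
  rewrite !(numberS _ (l %% n).+1); cbv beta.
  by rewrite e Ed -/(output w _) cmp_refine ?ltn_ord.
have lmn : (l %% n).+1 = n.
  apply: anti_leq; rewrite lm dvdn_leq //.
  by have := dv; rewrite {1}ld -addnS dvdn_addr ?dvdn_mull.
have e : t + n * (l %/ n).+1 + 0 = t + l.+1.
  by rewrite addn0 [in RHS]ld -addnS lmn mulnS addnC [_ * n]mulnC addnC [n + _]addnC.
have := no_success (l %/ n); rewrite divnS // dv add1n ltnSn => /(_ isT).
rewrite /success negb_and lmn !(numberS _ 0) ![number _ 0]/= !muln0 !add0n e.
rewrite -/(block (input w) t (l %/ n)) -/(block (output w) t (l %/ n)).
rewrite [phase _ _ _.+1]/= -/(output w (t + l.+1)) Ed.
set u := block _ _ _; set v := block _ _ _.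
have -> : (cmp u v == None) = (u == v) by rewrite /cmp; case: (u == v).
by case: (u == v); case: phase.
Qed.

End Automaton.

(** * The lookahead is necessary *)

Lemma eq_run_state (Sigma : finType) (A : streett_cost Sigma) w w' s :
  (forall i, i < s -> w i = w' i) -> run_state A w s = run_state A w' s.
Proof.
elim: s => //= s IHs eq_ww'; rewrite eq_ww' // IHs // => i lt_is.
exact/eq_ww'/ltnW.
Qed.

Lemma eq_outcome (SI SO : finType) (f : nat -> nat) (tau : seq SI -> SO) m x y i :
  \sum_(j < i.+1) f j <= i + m -> 0 < m -> (forall k, k < i + m -> x k = y k) ->
  outcome f tau x i = outcome f tau y i.
Proof.
move=> le_f m_gt0 eq_xy; rewrite /outcome eq_xy; last by lia.
congr (_, tau _); apply/eq_in_map => k; rewrite mem_iota add0n => /= lt_k.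
by apply: eq_xy; apply: leq_trans le_f.
Qed.

Lemma no_lookahead_sum (f : nat -> nat) m i : delay_function f -> ~ grants_lookahead f m ->
  \sum_(j < i.+1) f j <= i + m.
Proof.
move=> f_gt0 no; rewrite leqNgt; apply/negP => lt_f; apply: no; exists i.
have: \sum_(j < i.+1) f j = \sum_(j < i.+1) (f j - 1 + 1).
  by apply: eq_bigr => j _; rewrite subnK ?f_gt0.
rewrite big_split /= sum_nat_const card_ord muln1 => eq_f; move: lt_f; rewrite eq_f.
by rewrite [X in _ < X]addnC addSn ltnS leq_add2l.
Qed.

Section Spoiler.
Variables (n : nat) (n_gt0 : 0 < n).
Notation automaton := (automaton n_gt0).
Variables (K : nat) (lt_logn : forall k, k < K -> logn 2 k.+1 < 3 ^ n).

Lemma inc_count_bit w kb s r : inc_count automaton (Some kb) w s r = r - s.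
Proof. by rewrite /inc_count /= sum_nat_const_nat muln1. Qed.

Lemma inc_count_done w s r : inc_count automaton None w s r = 0.
Proof. by rewrite /inc_count /= big1. Qed.

(* The first [K] blocks do not depend on [c], and contain no bad pair at all. *)
Definition spoiler_block (c k : nat) : nat := if k < K then logn 2 k.+1 else c == 0 : nat.

Lemma spoiler_block_lt c k : spoiler_block c k < 3 ^ n.
Proof.
have n3 : 3 <= 3 ^ n by rewrite -[X in X <= _]expn1 leq_exp2l.
rewrite /spoiler_block; case: ifP => [|_]; first exact: lt_logn.
by case: eqP => _; lia.
Qed.

(** If [q < K], a larger valuation lies between the two ends; if [q >= K], block [q] differs from
    [c] by construction. *)
Lemma spoiler_block_no_bad_pair c p q : ~ bad_pair (spoiler_block c) c p q.
Proof.
rewrite /spoiler_block => -[lt_pq]; case: (ltnP q K) => [lt_qK|_ _].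
  rewrite (ltn_trans lt_pq lt_qK) => ap aq le_c.
  have [[|r] [//= /andP[lt_pr lt_rq] lt_cr]] := logn2_between (ltn0Sn p) (lt_pq : p.+1 < q.+1) ap aq.
  have := le_c r; rewrite -ltnS lt_pr -ltnS lt_rq => /(_ isT).
  by rewrite (ltn_trans _ lt_qK) // leqNgt lt_cr.
by case: c.
Qed.

Definition spoiler (x : nat -> option 'I_3) T c i : option 'I_3 :=
  if i < T then x i else if i == T then None else
  let l := i - T.+1 in
  Some (inord (digit n (spoiler_block c (l %/ n)) (l %% n))).

Lemma eq_spoiler x T c c' i : i < T.+1 + n * K -> spoiler x T c i = spoiler x T c' i.
Proof.
move=> lt_i; rewrite /spoiler; case: ltnP => // le_Ti; case: eqP => // /eqP neq.
by rewrite /= /spoiler_block ltn_divLR // [K * n]mulnC ltn_subLR ?lt_i // ltn_neqAle eq_sym neq.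
Qed.

Variables (f : nat -> nat) (tau : seq (option 'I_3) -> 'I_3) (m : nat).
Hypothesis le_f : forall i, \sum_(j < i.+1) f j <= i + m.
Hypothesis m_gt0 : 0 < m.
Hypothesis le_m : n + m <= n * K.

Section Word.
Variables (x : nat -> option 'I_3) (T c : nat).
Let w := outcome f tau (spoiler x T c).

Lemma run_spoiler_reset : run_state automaton w T.+1 = inl true.
Proof. by rewrite run_stateS /= /step /= /spoiler ltnn eqxx. Qed.

Lemma spoiler_no_reset i : (w (T.+1 + i)).1 != None.
Proof. rewrite /= /spoiler ifF ?ifF //; lia. Qed.

Lemma block_spoiler k : block n (input w) T.+1 k = spoiler_block c k.
Proof.
have -> : spoiler_block c k = number (digit n (spoiler_block c k)) n.
  by rewrite number_digit ?spoiler_block_lt // subnn divn1.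
apply: eq_number => i lt_in; rewrite /input /= /spoiler.
rewrite ifF ?ifF; [|lia|lia].
have -> : T.+1 + n * k + i - T.+1 = k * n + i by lia.
by rewrite divnMDl // divn_small // addn0 modnMDl modn_small // inordK ?digit_lt3.
Qed.

Hypothesis block0 : block n (output w) T.+1 0 = c.

(** All complete blocks among the first [l + n] output digits equal [c], so a success would yield a
    bad pair for [c]. *)
Lemma spoiler_consistent l : (forall i, i < l -> output w (T.+1 + i + n) = output w (T.+1 + i)) ->
  forall k, k < (l + n) %/ n -> ~~ success (block n (input w) T.+1) (block n (output w) T.+1) k.
Proof.
move=> per k lt_k.
have out_eq j i : i < n -> n * j + i < l + n ->
    output w (T.+1 + n * j + i) = output w (T.+1 + i).
  move=> lt_in; elim: j => [|j IHj] lt_l; first by rewrite muln0 addn0.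
  have e : T.+1 + n * j.+1 + i = T.+1 + (n * j + i) + n by rewrite mulnS; lia.
  rewrite mulnS in lt_l; rewrite e per ?addnA ?IHj //; lia.
have blk j : j <= k -> block n (output w) T.+1 j = c.
  move=> le_jk; rewrite -block0; apply: eq_number => i lt_in.
  rewrite muln0 addn0; apply: out_eq => //.
  have : n * j.+1 <= l + n.
    by rewrite mulnC -leq_divRL //; apply: leq_trans lt_k.
  by rewrite mulnS; lia.
apply/negP => /(success_bad_pair blk)[p].
case=> lt_pk; rewrite !block_spoiler => ap ak le_c.
apply: (@spoiler_block_no_bad_pair c p k); split=> // r hr.
by rewrite -block_spoiler; apply: le_c.
Qed.

Lemma spoiler_running l : (forall i, i < l -> output w (T.+1 + i + n) = output w (T.+1 + i)) ->
  forall i, i <= l + n -> tick (run_state automaton w (T.+1 + i).+1) =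
    Some (clock n_gt0 i, (w (T.+1 + i)).2).
Proof.
move=> per i le_i; rewrite run_round //; first exact: run_spoiler_reset.
- by move=> *; apply: spoiler_no_reset.
- move=> k lt_k; apply: (spoiler_consistent per); apply: leq_trans lt_k _.
  exact: leq_div2r.
Qed.

(* If Player O never changes a digit, then she never succeeds and the pair [None]
   has infinite cost. *)
Lemma spoiler_change : accepting automaton w ->
  exists l, output w (T.+1 + l + n) != output w (T.+1 + l).
Proof.
move=> acc; apply: contrapT => none.
have per i : output w (T.+1 + i + n) = output w (T.+1 + i).
  by apply/eqP; apply: contrapT => /negP neq; apply: none; exists i.
have run i : tick (run_state automaton w (T.+1 + i).+1) = Some (clock n_gt0 i, (w (T.+1 + i)).2).
  by apply: (@spoiler_running i) => //; apply: leq_addr.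
have run' i : T.+1 < i -> ~~ idle (run_state automaton w i).
  move=> lt_i; have := run (i - T.+2); have -> : (T.+1 + (i - T.+2)).+1 = i by lia.
  by case: (run_state automaton w i : state n).
move: acc; rewrite /accepting ltNge => /negP; apply; apply: limn_esup_ge_frequently => N.
exists (T.+2 + N); first by lia.
apply: (@StCor_ge _ automaton w _ None); first by rewrite inE run' //; lia.
move=> r le_r; rewrite inE orbF => idle_r.
by have := run' r; rewrite idle_r => /(_ ltac:(lia)).
Qed.

End Word.

(** Each transition costs one, so missing the deadline of [n] transitions costs at least [n.+1]. *)
Lemma StCor_change w s kb :
  run_state automaton w s \in request (Some kb) ->
  (forall r, s <= r <= s + n -> run_state automaton w r \notin response n_gt0 (Some kb)) ->
  (n.+1%:R%:E <= StCor automaton w s)%E.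
Proof.
move=> req no_resp; apply: (@StCor_ge _ automaton w _ (Some kb)) => // r le_sr resp.
rewrite lee_fin ler_nat inc_count_bit ltn_subRL ltnNge; apply/negP => le_r.
by have := no_resp r; rewrite le_sr le_r resp => /(_ isT).
Qed.

(** After a restart at [T], Player O's first changed digit is expensive. The bound holds for all
    continuations beyond [T'], so that stages can be chained. *)
Lemma spoiler_stage (x : nat -> option 'I_3) T :
  (forall y, accepting automaton (outcome f tau y)) ->
  exists y T' s, [/\ T < T', T <= s, forall i, i < T -> y i = x i &
    forall z, (forall i, i < T' -> z i = y i) ->
      (n.+1%:R%:E <= StCor automaton (outcome f tau z) s)%E].
Proof.
move=> acc.
(* Within her lookahead Player O sees only the first [K] blocks while announcing, so she announces
   the same [c] against [spoiler x T c]. *)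
set c := block n (output (outcome f tau (spoiler x T 0))) T.+1 0.
set w := outcome f tau (spoiler x T c).
have block0 : block n (output w) T.+1 0 = c.
  apply: eq_number => i lt_in; rewrite muln0 addn0 /output.
  congr (nat_of_ord _.2); apply: (@eq_outcome _ _ _ _ m) => // k lt_k.
  by apply: eq_spoiler; lia.
have [l neq min_l] := ex_minnP (spoiler_change block0 (acc _)).
have {min_l} per i : i < l -> output w (T.+1 + i + n) = output w (T.+1 + i).
  by move=> lt_il; apply/eqP; apply: contraTT lt_il => /min_l; rewrite -leqNgt.
have run := spoiler_running block0 per.
(* The cost at [s] is decided by the run up to [s + n], whose letters depend on the input below
   [s + n + m]. *)
exists (spoiler x T c), ((T.+1 + l).+1 + n + m), (T.+1 + l).+1; split; try lia.
- by move=> i lt_iT; rewrite /spoiler lt_iT.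
- move=> z eq_z.
have eq_run r : r <= (T.+1 + l).+1 + n ->
    run_state automaton (outcome f tau z) r = run_state automaton w r.
  move=> le_r; apply: eq_run_state => i lt_ir.
  by apply: (@eq_outcome _ _ _ _ m) => // k lt_k; apply: eq_z; lia.
apply: (@StCor_change _ _ (clock n_gt0 l, (w (T.+1 + l)).2)).
  have := run l (leq_addr _ _); rewrite inE eq_run ?leq_addr //.
  by case: (run_state automaton w (T.+1 + l).+1 : state n) => [//|q] /= ->; rewrite eqxx.
move=> r /andP[le_r1 le_r2]; rewrite eq_run // inE.
have [i [-> le_i]] : exists i, r = (T.+1 + (l + i)).+1 /\ i <= n.
  by exists (r - (T.+1 + l).+1); lia.
have := run (l + i); rewrite leq_add2l => /(_ le_i).
set q : state n := run_state automaton w _ => tick_q.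
have -> /= : idle q = false by case: q tick_q.
rewrite tick_q; apply/negP => /eqP[/eqP eq_clock eq_digit].
(* Modulo [2n], the requested clock value appears within [n] transitions only after exactly [n],
   where the digit has changed. *)
move: eq_clock; rewrite modnDml eqn_modDl => /eqP; rewrite !modn_small; [|lia|lia] => eq_in.
by case/eqP: neq; rewrite -addnA -eq_in; apply: (congr1 val eq_digit).
Qed.

(** Stage [k] fixes at least [k] letters, so the stages converge to one input, with an expensive
    position beyond every bound. *)
Lemma spoiler_limit : (forall y, accepting automaton (outcome f tau y)) ->
  exists z, (n.+1%:R%:E <= limn_esup (StCor automaton (outcome f tau z)))%E.
Proof.
move=> acc.
have /choice[g gP] (p : (nat -> option 'I_3) * nat) :
    exists q : (nat -> option 'I_3) * nat,
    [/\ p.2 < q.2, forall i, i < p.2 -> q.1 i = p.1 i & exists2 s, p.2 <= s &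
      forall z, (forall i, i < q.2 -> z i = q.1 i) ->
        (n.+1%:R%:E <= StCor automaton (outcome f tau z) s)%E].
  have [y [T [s [lt_T le_s eq_y y_s]]]] := spoiler_stage p.1 p.2 acc.
  by exists (y, T); split=> //; exists s.
pose h k := iter k g ((fun=> None), 0).
have le_h k : k <= (h k).2.
  by elim: k => // k IHk; have [lt_h _ _] := gP (h k); apply: leq_ltn_trans lt_h.
have eq_h j k i : j <= k -> i < (h j).2 -> i < (h k).2 /\ (h k).1 i = (h j).1 i.
  move=> /subnKC <- lt_i; elim: (k - j) => [|d [lt_id <-]]; first by rewrite addn0.
  rewrite addnS; have [lt_h eq_g _] := gP (h (j + d)).
  by split; [apply: ltn_trans lt_h | apply: eq_g].
pose z i := (h i.+1).1 i.
have zP k i : i < (h k).2 -> z i = (h k).1 i.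
  move=> lt_i; rewrite /z; case: (leqP i.+1 k) => [le_ik|/ltnW le_ki].
    by have [_ ->] := eq_h _ _ i le_ik (le_h _).
  by have [_ ->] := eq_h _ _ i le_ki lt_i.
exists z; apply: limn_esup_ge_frequently => N.
have [_ _ [s le_s z_s]] := gP (h N).
exists s; first exact: leq_trans (le_h N) le_s.
by apply: z_s => i; apply: (zP N.+1).
Qed.

End Spoiler.

Lemma lookahead_necessary n (n_gt0 : 0 < n) (f : nat -> nat) (tau : seq (option 'I_3) -> 'I_3) :
  delay_function f -> winning_strategy f (automaton n_gt0) tau ->
  strategy_cost f (automaton n_gt0) tau = n%:R%:E ->
  grants_lookahead f (n * (2 ^ 2 ^ n - 1)).
Proof.
move=> f_gt0 win cost_n; apply: contrapT => no.
have lt_logn k : k < (2 ^ 3 ^ n).-1 -> logn 2 k.+1 < 3 ^ n.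
  move=> lt_k; rewrite -(@ltn_exp2l 2) //; apply: (@leq_ltn_trans k.+1).
    by apply: dvdn_leq => //; apply: pfactor_dvdnn.
  by rewrite -[_ ^ _ ^ _]prednK // expn_gt0.
have m_gt0 : 0 < n * (2 ^ 2 ^ n - 1).
  by rewrite muln_gt0 n_gt0 subn_gt0 -{1}(expn0 2) ltn_exp2l // expn_gt0.
(* Base 3 instead of 2 makes room for the additional block during which [c] is announced. *)
have le_m : n + n * (2 ^ 2 ^ n - 1) <= n * (2 ^ 3 ^ n).-1.
  rewrite -mulnS subn1 prednK ?expn_gt0 // leq_pmul2l //.
  by rewrite -ltnS prednK ?expn_gt0 // ltn_exp2l // ltn_exp2r.
have le_f i := no_lookahead_sum i f_gt0 no.
have [z] := spoiler_limit lt_logn le_f m_gt0 le_m win.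
apply/negP; rewrite -ltNge; apply: (@le_lt_trans _ _ n%:R%:E).
  by rewrite -cost_n; apply: ereal_sup_ubound; exists z.
by rewrite lte_fin ltr_nat.
Qed.

(** * A strategy of cost n *)

Lemma eq_bad_pair A A' c p q : (forall k, k <= q -> A k = A' k) ->
  bad_pair A c p q -> bad_pair A' c p q.
Proof.
move=> eqA [lt_pq Ap Aq le_c]; split=> //; rewrite -?eqA //; first exact: ltnW.
by move=> r /andP[lt_pr lt_rq]; rewrite -eqA ?le_c ?lt_pr ?lt_rq // ltnW.
Qed.

Definition window n := 2 ^ 3 ^ n.

Lemma window_gt0 n : 0 < window n.
Proof. by rewrite expn_gt0. Qed.

Section Honest.
Variables (n : nat) (n_gt0 : 0 < n).
Notation automaton := (automaton n_gt0).
Notation step := (step n_gt0).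
Notation clock := (clock n_gt0).

Definition symbols (x : nat -> option 'I_3) t :=
  block n (fun i => if x i is Some d then nat_of_ord d else 0) t.

(** Confining the pair to the first [window n] blocks makes the choice computable from the
    lookahead. *)
Definition choices x t := [set c | c < 3 ^ n /\
  exists p q, q < window n /\ bad_pair (symbols x t) c p q].

Definition choose x t := xget 0 (choices x t).

Lemma chooseP x t : choices x t (choose x t).
Proof.
apply: xgetPex; have [k _|c [p [q [lt_c lt_q bad]]]] := @bad_pair_exists (symbols x t) (3 ^ n).
  by apply: number_lt => i; case: (x _).
by exists c; split=> //; exists p, q.
Qed.

Lemma eq_choose x y t : (forall i, i < t + n * window n -> x i = y i) ->
  choose x t = choose y t.
Proof.
move=> eq_xy.
have eq_sym k : k < window n -> symbols x t k = symbols y t k.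
  move=> lt_k; apply: eq_number => i lt_in; rewrite eq_xy //.
  have : n * k.+1 <= n * window n by rewrite leq_pmul2l.
  by rewrite mulnS; lia.
congr (xget 0 _); apply/seteqP; split=> c [lt_c [p [q [lt_q bad]]]].
  split=> //; exists p, q; split=> //; apply: eq_bad_pair bad => k le_k.
  by apply: eq_sym; apply: leq_ltn_trans lt_q.
split=> //; exists p, q; split=> //; apply: eq_bad_pair bad => k le_k.
by apply/esym/eq_sym; apply: leq_ltn_trans lt_q.
Qed.

Definition next_index (q : state n) : nat := if q is inr (k, _, _, _) then k.+1 %% n else 0.

Definition reply (q : state n) c : 'I_3 := inord (digit n c (next_index q)).

(** A strategy sees only the input, so Player O recomputes the run induced by her own replies,
    together with the announced number. *)
Fixpoint play x t : state n * nat :=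
  if t is s.+1 then
    let q := step (play x s).1 (x s, reply (play x s).1 (play x s).2) in
    (q, if q == inl true then choose x t else (play x s).2)
  else (inl true, choose x 0).

Lemma playS x t : play x t.+1 =
  let q := step (play x t).1 (x t, reply (play x t).1 (play x t).2) in
  (q, if q == inl true then choose x t.+1 else (play x t).2).
Proof. by []. Qed.

Lemma eq_play x y t : (forall i, i < t + n * window n -> x i = y i) ->
  play x t = play y t.
Proof.
elim: t => [|t IHt] eq_xy; first by rewrite /= (eq_choose eq_xy).
rewrite !playS (eq_choose eq_xy) IHt => [|i lt_i]; last by apply: eq_xy; lia.
by rewrite eq_xy // ltn_addr.
Qed.

Definition honest_delay i := if i is 0 then n * window n else 1.

Lemma sum_honest_delay i : \sum_(j < i.+1) honest_delay j = n * window n + i.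
Proof. by rewrite big_ord_recl /= sum_nat_const card_ord muln1. Qed.

(** The length of the prefix gives the round. By [eq_play], the default [None] beyond the prefix
    does not affect the reply. *)
Definition honest (s : seq (option 'I_3)) : 'I_3 :=
  let p := play (nth None s) (size s - n * window n) in reply p.1 p.2.

Lemma honest_outcome x t :
  outcome honest_delay honest x t = (x t, reply (play x t).1 (play x t).2).
Proof.
rewrite /outcome /honest sum_honest_delay size_mkseq addKn.
rewrite (@eq_play _ x) // => i lt_i; rewrite nth_mkseq //.
by rewrite addnC.
Qed.

Section Word.
Variable x : nat -> option 'I_3.
Let w := outcome honest_delay honest x.

Lemma run_honest t : run_state automaton w t = (play x t).1.
Proof.
elim: t => // t IHt; rewrite run_stateS playS IHt.
by rewrite /w honest_outcome.
Qed.

Lemma play_reset t : (play x t).1 = inl true -> (play x t).2 = choose x t.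
Proof. by case: t => // t; rewrite playS /= => ->; rewrite eqxx. Qed.

Lemma play_keep t : (play x t.+1).1 != inl true -> (play x t.+1).2 = (play x t).2.
Proof. by rewrite playS /= => /negPf ->. Qed.

Lemma tick_step q a k b : tick (step q a) = Some (k, b) ->
  [/\ b = a.2, k %% n = next_index q &
    forall k0 b0, tick q = Some (k0, b0) -> k = clock k0.+1].
Proof.
case: a => [[d|] o] //; case: q => [[|] //|[[[k0 b0] r] ph]].
  by case=> <- <-; split=> //=; rewrite !mod0n.
rewrite /step /=; have km l : clock l %% n = l %% n by exact: clock_modn.
case: ifP => _; first case: ifP => _ //.
all: by case=> <- <-; split=> [//||k1 b1 [<-] //]; rewrite km.
Qed.

Lemma tick_honest s k b : tick (play x s).1 = Some (k, b) ->
  b = inord (digit n (play x s).2 (k %% n)).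
Proof.
case: s => // s; rewrite playS /= => tick_s; have [-> -> _] := tick_step tick_s.
rewrite ifF //; by case: step tick_s.
Qed.

(** Either an idle state comes within [n] transitions and answers, or the number is kept and the
    same digit returns after [n]. *)
Lemma honest_answers s k b : tick (play x s).1 = Some (k, b) ->
  exists2 r, r <= n & (play x (s + r)).1 \in response n_gt0 (Some (k, b)).
Proof.
move=> tick_s.
case: (boolP [exists r : 'I_n.+1, idle (play x (s + r)).1]) => [/existsP[r idle_r]|no_idle].
  by exists r; [exact: leq_ord | rewrite inE idle_r].
have {}no_idle r : r <= n -> ~~ idle (play x (s + r)).1.
  rewrite -ltnS => lt_r; apply: contra no_idle => idle_r.
  by apply/existsP; exists (Ordinal lt_r).
have main r : r <= n -> (play x (s + r)).2 = (play x s).2 /\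
    exists b', tick (play x (s + r)).1 = Some (clock (k + r), b').
  elim: r => [|r IHr] le_r.
    rewrite !addn0; split=> //; exists b; rewrite tick_s; congr (Some (_, _)).
    by apply: val_inj; rewrite /= modn_small.
  have [c_r [b' tick_r]] := IHr (ltnW le_r).
  have := no_idle r.+1 le_r; rewrite addnS => idle_r; split.
    by rewrite play_keep //; apply: contra idle_r => /eqP ->.
  move: idle_r; rewrite playS /=; set q := step _ _.
  case tick_q : (tick q) => [[k1 b1]|]; last by case: q tick_q => [|[[[? ?] ?] ?]].
  have [_ _ /(_ _ _ tick_r) ->] := tick_step tick_q.
  move=> _; exists b1; congr (Some (_, _)); apply: val_inj.
  by rewrite /= -addn1 modnDml addn1 addnS.
have [c_n [b' tick_n]] := main n (leqnn n).
exists n => //; rewrite inE tick_n (tick_honest tick_n) c_n (tick_honest tick_s).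
by rewrite clock_modn modnDr eqxx orbT.
Qed.

(** The chosen [c] has a bad pair and is repeated until success, as [bad_pair_success] requires. *)
Lemma honest_success t : (play x t).1 = inl true -> (forall i, t <= i -> x i != None) ->
  exists2 u, t <= u & (play x u).1 = inl false.
Proof.
move=> reset_t no_reset.
have run_t : run_state automaton w t = inl true by rewrite run_honest.
have nr i : (w (t + i)).1 != None by apply: no_reset; apply: leq_addr.
set c := choose x t.
set ok := success (block n (input w) t) (block n (output w) t).
have out_c k l : (forall j, j < k -> ~~ ok j) -> l < n * k.+1 ->
    (play x (t + l)).2 = c /\ next_index (play x (t + l)).1 = l %% n.
  move=> not_ok; elim: l => [|l IHl] lt_l.
    by rewrite addn0 reset_t mod0n play_reset.
  have : run_state automaton w (t + l).+1 = (play x (t + l).+1).1 by rewrite run_honest.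
  rewrite run_round // => [run_l|j lt_j]; last first.
    apply: not_ok; apply: leq_trans lt_j _.
    by rewrite -ltnS ltn_divLR // mulnC; apply: ltnW.
  have [<- _] := IHl (ltnW lt_l).
  rewrite addnS; split; first by rewrite play_keep // -run_l.
  by rewrite -run_l; apply: clock_modnS.
have [lt_c [p [q [_ bad]]]] : choices x t c by exact: chooseP.
have := @bad_pair_success _ (block n (output w) t) _ _ _ bad.
case=> [k not_ok|k0 _ ok_k0].
  rewrite -[RHS]divn1 -[X in c %/ X](expn0 3) -[X in 3 ^ X](subnn n) -number_digit //.
  apply: eq_number => i lt_in.
  have [|c_i index_i] := out_c k (n * k + i) not_ok; first by rewrite mulnS; lia.
  rewrite /output /w honest_outcome /reply -addnA c_i index_i.
  by rewrite inordK ?digit_lt3 // mulnC modnMDl modn_small.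
have [k /andP[/eqP AC ph_k] min_k] : exists2 k, ok k & forall j, j < k -> ~~ ok j.
  have [k ok_k min_k] := ex_minnP (ex_intro (fun k => ok k) k0 ok_k0).
  exists k => // j lt_jk; apply: contraL lt_jk => /min_k.
  by rewrite -leqNgt.
have ln : n * k + n.-1 = (n * k.+1).-1 by rewrite mulnS; lia.
have lk : (n * k + n.-1) %/ n = k.
  by rewrite mulnC divnMDl // divn_small ?addn0 // ltn_predL.
have lm : (n * k + n.-1) %% n = n.-1.
  by rewrite mulnC modnMDl modn_small // ltn_predL.
have := @run_round n n_gt0 w t (n * k + n.-1) run_t (fun i _ => nr i).
rewrite lk lm prednK // => /(_ min_k) run_k.
(* One transition reads the last letter of block [k], and the next one enters the success state. *)
exists (t + (n * k + n.-1)).+2; first lia.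
rewrite -run_honest run_stateS run_k /= /step.
have -> : (w (t + (n * k + n.-1)).+1).1 = x (t + (n * k + n.-1)).+1 by [].
have := no_reset (t + (n * k + n.-1)).+1; case: (x _) => [d|/(_ ltac:(lia))//] _.
rewrite dvdn_clockS -addnS prednK // dvdn_addl // dvdn_mulr //.
rewrite -/(block n (input w) t k) -/(block n (output w) t k) AC /cmp eqxx /=.
by move: ph_k; rewrite /ok => ->.
Qed.

(** Otherwise consider the last restart state up to [s], which exists as the initial state is one:
    success follows it and persists. *)
Lemma honest_idle s : exists2 r, s <= r & idle (play x r).1.
Proof.
apply: contrapT => no_idle.
have {}no_idle r : s <= r -> ~~ idle (play x r).1.
  by move=> le_sr; apply/negP => idle_r; apply: no_idle; exists r.
have [] := @ex_maxnP (fun t => (t <= s) && ((play x t).1 == inl true)) s.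
- by exists 0.
- by move=> t /andP[].
move=> t /andP[le_ts /eqP reset_t] max_t.
have no_reset i : t <= i -> x i != None.
  move=> le_ti; apply/negP => /eqP xi.
  have reset_i : (play x i.+1).1 = inl true by rewrite playS /= xi.
  have [le_is|lt_si] := leqP i.+1 s.
    by have := max_t i.+1; rewrite le_is reset_i eqxx => /(_ isT); lia.
  by have := no_idle i.+1 (ltnW lt_si); rewrite reset_i.
have [u le_tu done_u] := honest_success reset_t no_reset.
have done r : (play x (u + r)).1 = inl false.
  elim: r => [|r IHr]; first by rewrite addn0.
  rewrite addnS playS /= IHr /step /=.
  by have := no_reset (u + r) ltac:(lia); case: (x _).
by have := no_idle (u + s); rewrite done => /(_ ltac:(lia)).
Qed.

Lemma StCor_honest s : (StCor automaton w s <= n%:R%:E)%E.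
Proof.
apply: StCor_le => -[[k b]|]; rewrite run_honest inE => /andP[_ req].
  have [r le_r resp] := @honest_answers s k b (esym (eqP req)).
  exists (s + r); first by rewrite run_honest; split=> //; exact: leq_addr.
  by rewrite inc_count_bit addKn.
have [r le_sr idle_r] := honest_idle s.
by exists r; [rewrite run_honest inE idle_r | rewrite inc_count_done].
Qed.

End Word.

Lemma honest_winning : winning_strategy honest_delay automaton honest.
Proof.
move=> x; apply: (@le_lt_trans _ _ n%:R%:E); last by rewrite ltry.
exact/limn_esup_le_bound/StCor_honest.
Qed.

(* The period [n + 1] leaves exactly one block in each round, so that the request
   made by its first digit is answered only by the restart, after [n] transitions. *)
Definition resets i : option 'I_3 := if n.+1 %| i then None else Some ord0.

Lemma StCor_resets (f : nat -> nat) (tau : seq (option 'I_3) -> 'I_3) N :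
  (n%:R%:E <= StCor automaton (outcome f tau resets) (n.+1 * N).+2)%E.
Proof.
set w := outcome f tau resets; set t := (n.+1 * N).+1.
have run_t : run_state automaton w t = inl true.
  by rewrite run_stateS /= /step /= /resets dvdn_mulr.
have tick_r r : r < n -> tick (run_state automaton w (t + r).+1) =
    Some (clock r, (w (t + r)).2).
  move=> lt_r; rewrite run_round // => [i le_i|k].
    rewrite /= /resets ifN // /t addSn -addnS dvdn_addr ?dvdn_mulr //.
    by apply/negP => /dvdn_leq; lia.
  by rewrite divn_small.
apply: (@StCor_ge _ automaton w _ (Some (clock 0, (w t).2))).
  have := tick_r 0 n_gt0; rewrite addn0 inE.
  by set q : state n := run_state automaton w _; case: q => [//|q] /= ->; rewrite eqxx.
move=> r le_tr; rewrite inE lee_fin ler_nat inc_count_bit leqNgt => resp; apply/negP => lt_r.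
have e : r = (t + (r - t.+1)).+1 by lia.
have := tick_r (r - t.+1) lt_r; rewrite -e => tick_q; move: resp tick_q.
set q : state n := run_state automaton w _ => /orP[|/eqP ->]; first by case: q.
(* The answer needs clock value [n], but the clock stays below [n] throughout this single block. *)
case=> /eqP; rewrite mod0n add0n modn_small ?[X in _ == X]modn_small => [||]; lia.
Qed.

Lemma honest_cost : strategy_cost honest_delay automaton honest = n%:R%:E.
Proof.
apply/eqP; rewrite eq_le; apply/andP; split.
  apply: ge_ereal_sup => _ [x _ <-]; exact/limn_esup_le_bound/StCor_honest.
apply: le_ereal_sup_tmp; exists (limn_esup (StCor automaton (outcome honest_delay honest resets))).
  by exists resets.
apply: limn_esup_ge_frequently => N; exists (n.+1 * N).+2; first by lia.
exact: StCor_resets.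
Qed.

End Honest.

Local Open Scope ring_scope.

Theorem theorem8 :
  exists p : {poly nat}, forall n : nat, (0 < n)%N ->
    exists (SI SO : finType) (A : streett_cost (SI * SO)%type),
      (st_size A <= p.[n])%N /\
      (exists f : nat -> nat, delay_function f /\
         exists tau : seq SI -> SO,
           winning_strategy f A tau /\ strategy_cost f A tau = (n%:R)%:E) /\
      (forall f : nat -> nat, delay_function f ->
         forall tau : seq SI -> SO,
           winning_strategy f A tau -> strategy_cost f A tau = (n%:R)%:E ->
           grants_lookahead f (n * (2 ^ (2 ^ n) - 1))%N).
Proof.
exists (42%N%:P * 'X + 3%N%:P)%R => n n_gt0.
exists (option 'I_3), 'I_3, (automaton n_gt0); split; [|split].
- by rewrite size_automaton !hornerE leqnn.
- exists (honest_delay n); split.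
    by case=> [|//]; rewrite muln_gt0 n_gt0 window_gt0.
  exists (honest n_gt0); split; [exact: honest_winning | exact: honest_cost].
- by move=> f f_gt0 tau; apply: lookahead_necessary.
Qed.
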